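(* For $i=1,2$, let $(X_i,\tau_i)$ be a Tychonoff space, let $(Y_i,f_i)$ be a Hausdorff local compactification of $(X_i,\tau_i)$, and let $\eta_i$ and $\mathbb{B}_i$ be defined by: for $F,G\in RC(X_i)$, $F\eta_i G$ iff $\mathrm{cl}_{Y_i}(f_i(F))\cap\mathrm{cl}_{Y_i}(f_i(G))\neq\emptyset$, and $\mathbb{B}_i=\{f_i^{-1}(K) : K\in CR(Y_i)\}$. Let $f:X_1\to X_2$ be a continuous function. Then there exists a continuous function $g:Y_1\to Y_2$ such that $g\circ f_1=f_2\circ f$ if and only if $f$ satisfies the following two conditions: (REQ1) for every $F,G\in RC(X_2)$, $\ \mathrm{cl}_{X_1}(\mathrm{int}_{X_1}(f^{-1}(F)))\ \eta_1\ \mathrm{cl}_{X_1}(\mathrm{int}_{X_1}(f^{-1}(G)))$ implies $F\eta_2 G$; (REQ2) for every $F\in\mathbb{B}_1$ there exists $G\in\mathbb{B}_2$ such that $f(F)\subseteq G$.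
   Context: For a topological space $X$, $RC(X)$ denotes the set of all regular closed subsets of $X$ (sets $F$ with $F=\mathrm{cl}(\mathrm{int}(F))$) and $CR(X)$ the set of all compact regular closed subsets of $X$. A Hausdorff local compactification of a Tychonoff space $X$ is a pair $(Y,f)$ with $Y$ a locally compact Hausdorff space and $f:X\to Y$ a homeomorphic embedding with dense image. One has $\mathbb{B}_i\subseteq RC(X_i)$, and $\mathbb{B}_i$ is the set of those $F\in RC(X_i)$ for which $\mathrm{cl}_{Y_i}(f_i(F))$ is compact. *)

(* Defs.v *)
From HB Require Import structures.
From mathcomp Require Import all_boot all_order all_algebra.
From mathcomp Require Import all_classical all_reals all_analysis.

Set Implicit Arguments.
Unset Strict Implicit.
Unset Printing Implicit Defensive.

Local Open Scope classical_set_scope.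

Definition tychonoff_space (T : topologicalType) : Prop :=
  completely_regular_space T /\ hausdorff_space T.

Definition RC (T : topologicalType) : set (set T) :=
  [set F | regclosed F].

Definition CR (T : topologicalType) : set (set T) :=
  [set K | compact K /\ RC K].

(* The third component says that [f] is an open map onto its range, the range
   carrying the subspace topology; with the other two, [f] is a homeomorphism
   onto its range. *)
Definition homeomorphic_embedding (X Y : topologicalType) (f : X -> Y) : Prop :=
  [/\ injective f,
      continuous f &
      forall U : set X, open U -> open (f @` U : set (subspace (range f)))].

Definition hausdorff_local_compactification
    (X Y : topologicalType) (f : X -> Y) : Prop :=
  [/\ locally_compact [set: Y],
      hausdorff_space Y,
      homeomorphic_embedding f &
      dense (range f)].

(* [eta_rel f] is meaningful as a relation on [RC X] only; the restriction to
   regular closed arguments is left to the places where it is used. *)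
Definition eta_rel (X Y : topologicalType) (f : X -> Y) (F G : set X) : Prop :=
  closure (f @` F) `&` closure (f @` G) !=set0.

Definition BB (X Y : topologicalType) (f : X -> Y) : set (set X) :=
  [set f @^-1` K | K in @CR Y].

(* Main.v *)
Require Import Defs.
From HB Require Import structures.
From mathcomp Require Import all_boot all_order all_algebra.
From mathcomp Require Import all_classical all_reals all_analysis.

(** Everything rests on trace filters: for a map [e : X -> Y] with dense range
    and a point [y] of [Y], the preimages under [e] of the neighbourhoods of [y]
    generate a proper filter [trace e y] on [X].  A map [h] from [X] to a
    regular space extends continuously along [e] as soon as it converges along
    every trace filter ([extension_by_limits]), and when [e] is an embedding the
    extension restricts to [h].  So a continuous [g] with [g \o f1 = f2 \o f]
    exists once [f2 \o f] converges along every [trace f1 y].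

    Both conditions are exactly what this convergence needs.  The point [y] has
    a compact regular closed neighbourhood, whose preimage lies in [BB f1]; by
    the second condition the image of [trace f1 y] under [f2 \o f] then contains
    a compact set, hence has a cluster point.  By the first condition this
    cluster point is unique: two of them would have open neighbourhoods [V] and
    [W] with disjoint closures, the closures in [X2] of the traces of [V] and
    [W] are regular closed sets that are far apart for [eta_rel f2], while [y]
    witnesses that their pullbacks along [f] are near for [eta_rel f1].  A
    filter containing a compact set and having a single cluster point converges
    to it.

    Conversely, an extension [g] maps the closure of [f1 @` A] into the closure
    of [f2 @` (f @` A)], whence the first condition, and it maps a compact set to
    a compact set, which in a locally compact space lies in a compact regular
    closed one; that gives the second condition. *)

Set Implicit Arguments.
Unset Strict Implicit.
Unset Printing Implicit Defensive.

Local Open Scope classical_set_scope.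

(** * Regularity and compact regular closed sets *)

Lemma locally_compact_regular (T : topologicalType) :
  locally_compact [set: T] -> hausdorff_space T -> regular_space T.
Proof.
move=> lcT hT x; have [//|U] := lcT x; rewrite withinET => Ux [cU _].
exact: (compact_regular hT cU Ux).
Qed.

(** Open precompact sets are directed under union, so that a single one of them
    covers a compact set: this is [near_covering] for the filter generated by
    the up-closed families [set V | D V /\ U `<=` V]. *)
Lemma compact_sub_open_precompact (T : topologicalType) (K : set T) :
  locally_compact [set: T] -> compact K ->
  exists U : set T, [/\ open U, compact (closure U) & K `<=` U].
Proof.
move=> lcT /compact_near_coveringP covK.
pose D := [set U : set T | open U /\ compact (closure U)].
pose F := filter_from D (fun U => [set V | D V /\ U `<=` V]).
have D0 : D set0 by split; [exact: open0 | rewrite closure0; exact: compact0].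
have FF : Filter F.
  apply: filter_from_filter; first by exists set0.
  move=> U V [oU cU] [oV cV]; exists (U `|` V).
    by split; [exact: openU | rewrite closureU; exact: compactU].
  move=> W [DW UVW]; split; split => // z ?; apply: UVW; first by left.
  by right.
suff /(covK _ F (fun V x => V x) FF) [U [oU cU] /(_ U) KU] :
    forall x, K x -> \forall x' \near x & V \near F, V x'.
  exists U; split; [exact: oU | exact: cU |].
  by have := KU (conj (conj oU cU) (@subset_refl _ U)).
move=> x _; have [//|U] := lcT x; rewrite withinET => Ux [cU clU].
exists (U°, [set V | D V /\ U° `<=` V]); last first.
  by move=> [x' V] [/= Ux' [_ UV]]; exact: UV.
split; first exact: nbhs_interior.
exists U° => //; split; first exact: open_interior.
apply: (subclosed_compact _ cU); first exact: closed_closure.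
rewrite [X in _ `<=` X]((closure_id U).1 clU); apply: closureS.
exact: interior_subset.
Qed.

Lemma compact_sub_CR (T : topologicalType) (K : set T) :
  locally_compact [set: T] -> compact K ->
  exists L : set T, CR L /\ K `<=` L°.
Proof.
move=> lcT cK; have [U [oU cU KU]] := compact_sub_open_precompact lcT cK.
exists (closure U); split.
  by split; [exact: cU | exact: closure_open_regclosed].
apply: (subset_trans KU); rewrite -open_subsetE //; exact: subset_closure.
Qed.

Lemma regular_hausdorff_closure_separation (T : topologicalType) (p q : T) :
  regular_space T -> hausdorff_space T -> p <> q ->
  exists V W : set T, [/\ open_nbhs p V, open_nbhs q W &
    closure V `&` closure W = set0].
Proof.
move=> rT; rewrite open_hausdorff => hT /eqP pq.
have [[A B] /= [/set_mem pA /set_mem qB] [oA oB /eqP AB0]] := hT _ _ pq.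
have [V pV clVA] := rT p A (open_nbhs_nbhs (conj oA pA)).
have [W qW clWB] := rT q B (open_nbhs_nbhs (conj oB qB)).
exists V°, W°; split.
- by split; [exact: open_interior | exact: pV].
- by split; [exact: open_interior | exact: qW].
- apply: subsetI_eq0 AB0.
    by apply: subset_trans clVA; apply: closureS; exact: interior_subset.
  by apply: subset_trans clWB; apply: closureS; exact: interior_subset.
Qed.

Lemma compact_cluster1_cvg (T : topologicalType) (F : set_system T)
    (V : set T) (z : T) :
  locally_compact [set: T] -> hausdorff_space T -> ProperFilter F ->
  compact V -> F V -> cluster F = [set z] -> F --> z.
Proof.
move=> lcT hT PF cV FV cF; have [//|U] := lcT z; rewrite withinET => zU [cU _].
(* [compact_cluster_set1] asks for a compact neighbourhood of the limit *)
apply: (@compact_cluster_set1 _ z F (V `|` U)) => //.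
- exact: compactU.
- by apply: filterS zU; exact: subsetUr.
- by apply: filterS FV; exact: subsetUl.
Qed.

(** * Trace filters and extension by limits *)

Definition trace (X Y : topologicalType) (e : X -> Y) (y : Y) : set_system X :=
  filter_from (nbhs y) (fun N => e @^-1` N).

Lemma trace_filter (X Y : topologicalType) (e : X -> Y) (y : Y) :
  Filter (trace e y).
Proof.
apply: filter_from_filter; first by exists setT; exact: filterT.
by move=> A B yA yB; exists (A `&` B) => //; exact: filterI.
Qed.

Lemma trace_proper (X Y : topologicalType) (e : X -> Y) (y : Y) :
  dense (range e) -> ProperFilter (trace e y).
Proof.
move=> de; apply: filter_from_proper; first exact: trace_filter.
move=> N; rewrite nbhsE => -[B [oB By] BN].
have [|b [Bb [x _ exb]]] := de B _ oB; first by exists y.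
by exists x; apply: BN; rewrite exb.
Qed.

(** Being open onto the range is what makes the filter [trace e (e x)] fine
    enough: every neighbourhood of [x] then belongs to it. *)
Lemma trace_embedding (X Y : topologicalType) (e : X -> Y) (x : X) :
  homeomorphic_embedding e -> trace e (e x) --> x.
Proof.
move=> [inj_e _ open_e] U; rewrite nbhsE => -[A [oA Ax] AU].
have /open_subspaceP [V oV VE] := open_e A oA.
have Vrange z : V (e z) -> A z.
  move=> Vz; have : (V `&` range e) (e z) by split => //; exists z.
  by rewrite VE => -[[w Aw /inj_e <-]].
exists V; last by move=> z /Vrange /AU.
apply: open_nbhs_nbhs; split => //.
have : ((e @` A) `&` range e) (e x) by split; exists x.
by rewrite -VE => -[].
Qed.

(** Regularity of the target serves continuity: if [h] sends the trace of an
    open [B] into a closed set, the limits at the points of [B] stay in it. *)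
Lemma extension_by_limits (X Y Z : topologicalType) (e : X -> Y) (h : X -> Z) :
  dense (range e) -> regular_space Z ->
  (forall y, exists z : Z, h @ trace e y --> z) ->
  exists g : Y -> Z, continuous g /\ forall y, h @ trace e y --> g y.
Proof.
move=> de rZ /choice [g hg]; exists g; split => // y W gyW.
have [A gyA clAW] := rZ _ _ gyW.
have [N yN NA] := hg y _ gyA.
move: yN; rewrite nbhsE => -[B [oB By] BN].
exists B => // y' By'; apply: clAW.
have PF := trace_proper y' de.
apply: (closed_cvg (closure A) _ _ (g y') (hg y')).
  exact: closed_closure.
exists B; first exact: open_nbhs_nbhs.
by move=> x /= Bx; apply: subset_closure; apply: NA; exact: BN.
Qed.

Lemma embedding_extension (X Y Z : topologicalType) (e : X -> Y) (h : X -> Z) :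
  homeomorphic_embedding e -> dense (range e) ->
  regular_space Z -> hausdorff_space Z -> continuous h ->
  (forall y, exists z : Z, h @ trace e y --> z) ->
  exists g : Y -> Z, continuous g /\ g \o e = h.
Proof.
move=> he de rZ hZ hc /(extension_by_limits de rZ) [g [gc hg]].
exists g; split => //; apply/funext => x /=.
have PF := trace_proper (e x) de.
have FF := trace_filter e (e x).
apply: (@cvg_unique _ hZ (h @ trace e (e x))); first exact: hg.
by move=> W /hc; exact: trace_embedding.
Qed.

(** * Necessity of the two conditions *)

Lemma image_closure_continuous (S T : topologicalType) (g : S -> T)
    (A : set S) :
  continuous g -> g @` closure A `<=` closure (g @` A).
Proof.
move=> gc _ [y Ay <-] B /gc /Ay [z [Az Bz]].
by exists (g z); split => //; exists z.
Qed.

Section Necessity.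
Context (X1 X2 Y1 Y2 : topologicalType).
Context (f1 : X1 -> Y1) (f2 : X2 -> Y2) (f : X1 -> X2) (g : Y1 -> Y2).
Hypotheses (gc : continuous g) (gf : g \o f1 = f2 \o f).

Lemma extension_reflects_eta (F G : set X2) : continuous f ->
  closed F -> closed G ->
  eta_rel f1 (closure (f @^-1` F)°) (closure (f @^-1` G)°) -> eta_rel f2 F G.
Proof.
move=> fc cF cG [y [yF yG]].
suff mapcl H : closed H -> closure (f1 @` closure (f @^-1` H)°) y ->
    closure (f2 @` H) (g y).
  by exists (g y); split; exact: mapcl.
move=> cH yH.
have : closure (g @` (f1 @` closure (f @^-1` H)°)) (g y).
  by apply: image_closure_continuous => //; exists y.
apply: closureS => _ [_ [x xH <-] <-].
rewrite -[g _]/((g \o f1) x) gf; exists (f x) => //.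
have cfH : closed (f @^-1` H) by move/continuous_closedP : fc; apply.
by apply: cfH; apply: closureS xH; exact: interior_subset.
Qed.

Lemma extension_bounded (F : set X1) : locally_compact [set: Y2] ->
  BB f1 F -> exists G, BB f2 G /\ f @` F `<=` G.
Proof.
move=> lc2 [K [cK _] <-].
have cgK : compact (g @` K).
  by apply: continuous_compact cK; exact: continuous_subspaceT.
have [L [CRL KL]] := compact_sub_CR lc2 cgK.
exists (f2 @^-1` L); split; first by exists L.
move=> _ [x Kx <-] /=; apply: interior_subset; apply: KL.
by exists (f1 x) => //; rewrite -[g _]/((g \o f1) x) gf.
Qed.

End Necessity.

(** * Convergence along trace filters *)

Section TraceConvergence.
Context (X1 X2 Y1 Y2 : topologicalType).
Context (f1 : X1 -> Y1) (f2 : X2 -> Y2) (f : X1 -> X2).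
Hypotheses (f2c : continuous f2) (fc : continuous f).

(** For an open neighbourhood [A] of a cluster point, the closure of
    [f2 @^-1` A] is regular closed and its image under [f2] stays in [closure A],
    while [y] is in the closure of the [f1]-image of its pullback along [f]; for
    two neighbourhoods with disjoint closures, this contradicts the hypothesis
    on [eta_rel]. *)
Lemma eta_cluster_unique : regular_space Y2 -> hausdorff_space Y2 ->
  (forall F G : set X2, RC F -> RC G ->
     eta_rel f1 (closure (f @^-1` F)°) (closure (f @^-1` G)°) ->
     eta_rel f2 F G) ->
  forall y, is_subset1 (cluster ((f2 \o f) @ trace f1 y)).
Proof.
move=> r2 h2 req1 y p q clp clq; apply: contrapT => pq.
have [V [W [pV qW VW0]]] := regular_hausdorff_closure_separation r2 h2 pq.
pose R (A : set Y2) := closure (f2 @^-1` A).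
have RC_R A : open A -> RC (R A).
  by move=> oA; apply: closure_open_regclosed; exact: open_comp.
have near_y A z : open_nbhs z A -> cluster ((f2 \o f) @ trace f1 y) z ->
    closure (f1 @` closure (f @^-1` R A)°) y.
  move=> zA clz N yN; have oA := zA.1.
  have imN : ((f2 \o f) @ trace f1 y) ((f2 \o f) @` (f1 @^-1` N)).
    by exists N => // x Nx; exists x.
  have [_ [[x Nx <-] Ax]] := clz _ _ imN (open_nbhs_nbhs zA).
  exists (f1 x); split => //; exists x => //; apply: subset_closure.
  suff : f @^-1` (f2 @^-1` A) `<=` (f @^-1` R A)° by apply.
  rewrite -open_subsetE; last by do 2?apply: open_comp.
  by move=> x' Ax'; exact: subset_closure.
have far A : f2 @` R A `<=` closure A.
  apply: subset_trans (image_closure_continuous f2c) _.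
  by apply: closureS; exact: image_preimage_subset.
have [|z [zV zW]] := req1 (R V) (R W) (RC_R _ pV.1) (RC_R _ qW.1).
  by exists y; split; [exact: near_y clp | exact: near_y clq].
suff : (closure V `&` closure W) z by rewrite VW0.
split; first exact: (closed_closure (closureS (@far V) zV)).
exact: (closed_closure (closureS (@far W) zW)).
Qed.

Lemma bounded_trace_compact (y : Y1) : locally_compact [set: Y1] ->
  (forall F, BB f1 F -> exists G, BB f2 G /\ f @` F `<=` G) ->
  exists2 L, compact L & ((f2 \o f) @ trace f1 y) L.
Proof.
move=> lc1 req2.
have [K [CRK yK]] := compact_sub_CR lc1 (@compact_set1 _ y).
have [|G [[L [cL _] <-] fKL]] := req2 (f1 @^-1` K); first by exists K.
exists L => //; exists K; first exact: yK.
by move=> x Kx; apply: fKL; exists x.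
Qed.

End TraceConvergence.

Theorem theorem3p1 (X1 X2 Y1 Y2 : topologicalType)
    (f1 : X1 -> Y1) (f2 : X2 -> Y2)
    (hX1 : tychonoff_space X1) (hX2 : tychonoff_space X2)
    (hf1 : hausdorff_local_compactification f1)
    (hf2 : hausdorff_local_compactification f2)
    (f : X1 -> X2) (hf : continuous f) :
  (exists g : Y1 -> Y2, continuous g /\ g \o f1 = f2 \o f) <->
  ((forall F G : set X2, RC F -> RC G ->
      eta_rel f1 (closure ((f @^-1` F)°)) (closure ((f @^-1` G)°)) -> eta_rel f2 F G) /\
   (forall F : set X1, BB f1 F ->
      exists G : set X2, BB f2 G /\ f @` F `<=` G)).
Proof.
have [lc1 _ emb1 d1] := hf1; have [lc2 h2 [_ f2c _] _] := hf2.
have RC_closed (H : set X2) : RC H -> closed H.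
  by move=> <-; exact: closed_closure.
split=> [[g [gc gf]]|[req1 req2]].
  split=> [F G /RC_closed cF /RC_closed cG|F].
    exact: (extension_reflects_eta gc gf).
  exact: (extension_bounded gc gf).
have r2 := locally_compact_regular lc2 h2.
apply: embedding_extension => //.
  by move=> x; apply: continuous_comp; [exact: hf | exact: f2c].
move=> y; have PF := trace_proper y d1.
have [L cL FL] := bounded_trace_compact y lc1 req2.
have [z [_ clz]] := cL _ _ FL.
exists z; apply: (compact_cluster1_cvg lc2 h2 _ cL FL).
apply/seteqP; split=> [w clw|_ ->//].
exact: (eta_cluster_unique f2c hf r2 h2 req1 clw clz).
Qed.
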